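(* Let $\mathbf A=\alpha\mathbf I+\mathbf S\in\mathbb R^{n\times n}$ with $\alpha\in\mathbb R$, $\alpha\neq 0$, $\mathbf S^\top=-\mathbf S$, and let $\mathbf b\in\mathbb R^n$ be nonzero. Let $\mathbf x_k^{\rm L}$ and $\mathbf x_k^{\rm G}$ be the iterates generated at iteration $k$ of S$^3$LQ and S$^3$CG for $\mathbf A\mathbf x=\mathbf b$, respectively. As long as the algorithms have not yet converged (i.e., no iterate of index smaller than $2j$ equals $\mathbf A^{-1}\mathbf b$), we have $$\mathbf x_{2j}^{\rm L}=\mathbf x_{2j+1}^{\rm L}=\mathbf x_{2j}^{\rm G}\qquad\text{for } j\geq 1.$$
   Context: Exact arithmetic is assumed. $\mathcal K_k(\mathbf A,\mathbf b)=\mathrm{span}\{\mathbf b,\mathbf A\mathbf b,\dots,\mathbf A^{k-1}\mathbf b\}$ (with $\mathcal K_0=\{\mathbf 0\}$). The S$^3$LQ iterate $\mathbf x_k^{\rm L}$ ($k\ge1$) is the vector of minimal Euclidean norm among all $\mathbf x\in\mathcal K_k(\mathbf A,\mathbf b)$ satisfying $\mathbf b-\mathbf A\mathbf x\perp\mathcal K_{k-1}(\mathbf A,\mathbf b)$. The S$^3$CG iterate $\mathbf x_k^{\rm G}$ ($k\ge1$) is the unique vector with $\mathbf x_k^{\rm G}\in\mathcal K_k(\mathbf A,\mathbf b)$ and $\mathbf b-\mathbf A\mathbf x_k^{\rm G}\perp\mathcal K_k(\mathbf A,\mathbf b)$; $\mathbf x_0^{\rm G}=\mathbf 0$. *)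

(* Defs.v *)
From HB Require Import structures.
From mathcomp Require Import all_boot all_order all_algebra.
From mathcomp Require Import reals.
Set Implicit Arguments.
Unset Strict Implicit.
Unset Printing Implicit Defensive.
Import Order.TTheory GRing.Theory Num.Theory.
Local Open Scope ring_scope.

Definition dot (R : realType) (n : nat) (u v : 'cV[R]_n) : R :=
  \sum_(i < n) u i 0 * v i 0.

(* The norm [`|x|] that MathComp-Analysis puts on matrices is the sup norm,
   hence this separate definition. *)
Definition euclid_norm (R : realType) (n : nat) (x : 'cV[R]_n) : R :=
  Num.sqrt (dot x x).

Definition orthogonal_to (R : realType) (n : nat) (r : 'cV[R]_n)
    (U : {vspace 'cV[R]_n}) : Prop :=
  forall v, v \in U -> dot r v = 0.

Definition krylov (R : realType) (n : nat) (A : 'M[R]_n) (b : 'cV[R]_n)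
    (k : nat) : {vspace 'cV[R]_n} :=
  <<[seq A ^+ i *m b | i <- iota 0 k]>>%VS.

Definition S3LQ_feasible (R : realType) (n : nat) (A : 'M[R]_n) (b : 'cV[R]_n)
    (k : nat) (x : 'cV[R]_n) : Prop :=
  x \in krylov A b k /\ orthogonal_to (b - A *m x) (krylov A b k.-1).

(* Only meaningful for [0 < k], because of the truncated [k.-1]. *)
Definition is_S3LQ_iterate (R : realType) (n : nat) (A : 'M[R]_n)
    (b : 'cV[R]_n) (k : nat) (x : 'cV[R]_n) : Prop :=
  S3LQ_feasible A b k x /\
  forall y, S3LQ_feasible A b k y -> euclid_norm x <= euclid_norm y.

Definition is_S3CG_iterate (R : realType) (n : nat) (A : 'M[R]_n)
    (b : 'cV[R]_n) (k : nat) (x : 'cV[R]_n) : Prop :=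
  x \in krylov A b k /\ orthogonal_to (b - A *m x) (krylov A b k).

(* The two predicates above determine a vector: existence and uniqueness of
   the iterates, for every [k], for a nonzero shift of a skew-symmetric matrix. *)
Section WellDefined.
Variables (R : realType) (n : nat).
Implicit Types (u v w x y : 'cV[R]_n) (U : {vspace 'cV[R]_n}) (A S : 'M[R]_n).

Lemma dotE u v : dot u v = (u^T *m v) 0 0.
Proof. by rewrite mxE; apply: eq_bigr => i _; rewrite mxE. Qed.

Lemma dotC u v : dot u v = dot v u.
Proof. by apply: eq_bigr => i _; rewrite mulrC. Qed.

Lemma dotDl u v w : dot (u + v) w = dot u w + dot v w.
Proof. by rewrite !dotE linearD mulmxDl mxE. Qed.

Lemma dotBl u v w : dot (u - v) w = dot u w - dot v w.
Proof. by rewrite !dotE linearB mulmxBl !mxE. Qed.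

Lemma dotZl a u v : dot (a *: u) v = a * dot u v.
Proof. by rewrite !dotE linearZ -scalemxAl mxE. Qed.

Lemma dot_ge0 u : 0 <= dot u u.
Proof. by apply: sumr_ge0 => i _; rewrite -expr2 sqr_ge0. Qed.

Lemma dot_eq0 u : dot u u = 0 -> u = 0.
Proof.
move=> /eqP; rewrite psumr_eq0 => [/allP u0|i _]; last by rewrite -expr2 sqr_ge0.
apply/matrixP => i j; rewrite ord1 mxE; apply/eqP.
by have := u0 i (mem_index_enum i); rewrite mulf_eq0 orbb.
Qed.

Lemma skew_dot0 S u : S^T = - S -> dot (S *m u) u = 0.
Proof.
move=> hS; have : dot (S *m u) u = - dot (S *m u) u.
  rewrite [in RHS]dotC !dotE trmx_mul hS mulmxN mulNmx mxE; congr (- _).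
  by rewrite mulmxA.
by move/eqP; rewrite -addr_eq0 -mulr2n mulrn_eq0 => /eqP.
Qed.

Lemma shifted_dot alpha S u : S^T = - S ->
  dot ((alpha%:M + S) *m u) u = alpha * dot u u.
Proof.
by move=> hS; rewrite mulmxDl mul_scalar_mx dotDl dotZl skew_dot0 ?addr0.
Qed.

(* In particular [invmx A] is the genuine inverse, not its default value. *)
Lemma shifted_unitmx alpha S : alpha != 0 -> S^T = - S ->
  alpha%:M + S \in unitmx.
Proof.
move=> a0 hS; rewrite -unitmx_tr -row_free_unit -kermx_eq0; apply/rowV0P => u.
move=> /sub_kermxP /(congr1 trmx); rewrite trmx_mul trmxK trmx0 => Au0.
have := shifted_dot alpha u^T hS; rewrite Au0 dotE trmx0 mul0mx mxE.
move=> /esym/eqP; rewrite mulf_eq0 (negbTE a0) /= => /eqP/dot_eq0 u0.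
by rewrite -[u]trmxK u0 trmx0.
Qed.

Lemma galerkin_exists alpha S (b : 'cV[R]_n) U : alpha != 0 -> S^T = - S ->
  exists2 x, x \in U & orthogonal_to (b - (alpha%:M + S) *m x) U.
Proof.
move=> a0 hS; set A := alpha%:M + S; set X := vbasis U.
pose B := \matrix_(i < n, j < \dim U) (X`_j) i 0.
have BE (c : 'cV_(\dim U)) : B *m c = \sum_j c j 0 *: X`_j.
  apply/matrixP => i k; rewrite ord1 summxE mxE.
  by apply: eq_bigr => j _; rewrite !mxE mulrC.
have BU c : B *m c \in U.
  rewrite BE; apply: memv_suml => j _; apply/memvZ/vbasis_mem/mem_nth.
  by rewrite size_tuple.
have UB v : v \in U -> exists c, v = B *m c.
  move=> /coord_vbasis vE; exists (\col_j coord X j v).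
  by rewrite BE [LHS]vE; apply: eq_bigr => j _; rewrite mxE.
pose G := B^T *m A^T *m B.
have leGB : (G <= B)%MS by rewrite submxMl.
have kerG : (kermx G <= kermx B^T)%MS.
  apply/rV_subP => u /sub_kermxP uG; apply/sub_kermxP.
  have : dot (A *m (B *m u^T)) (B *m u^T) = 0.
    rewrite dotE !trmx_mul trmxK.
    have -> : u *m B^T *m A^T *m (B *m u^T) = u *m G *m u^T.
      by rewrite /G !mulmxA.
    by rewrite uG mul0mx mxE.
  rewrite shifted_dot // => /eqP; rewrite mulf_eq0 (negbTE a0) /= => /eqP.
  by move=> /dot_eq0 /(congr1 trmx); rewrite trmx_mul trmxK trmx0.
have leBG : (B <= G)%MS.
  rewrite -(geq_leqif (mxrank_leqif_sup leGB)).
  have := mxrankS kerG; rewrite !mxrank_ker mxrank_tr.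
  by rewrite leq_sub2lE ?rank_leq_col.
have /submxP[d bE] : (b^T *m B <= G)%MS by exact: submx_trans (submxMl _ _) leBG.
exists (B *m d^T) => // v /UB[c ->].
rewrite dotBl !dotE !trmx_mul trmxK.
have -> : b^T *m (B *m c) = d *m B^T *m A^T *m (B *m c).
  by rewrite mulmxA bE /G !mulmxA.
by rewrite subrr.
Qed.

Lemma S3CG_iterate_exists alpha S A b k :
  alpha != 0 -> S^T = - S -> A = alpha%:M + S ->
  exists x, is_S3CG_iterate A b k x.
Proof.
move=> a0 hS ->; have [x xK xo] := galerkin_exists b (krylov (alpha%:M + S) b k) a0 hS.
by exists x.
Qed.

Lemma S3CG_iterate_unique alpha S A b k x y :
  alpha != 0 -> S^T = - S -> A = alpha%:M + S ->
  is_S3CG_iterate A b k x -> is_S3CG_iterate A b k y -> x = y.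
Proof.
move=> a0 hS AE [xK xo] [yK yo]; apply/eqP; rewrite -subr_eq0; apply/eqP.
have dK : x - y \in krylov A b k by rewrite rpredB.
apply: dot_eq0; apply: (mulfI a0); rewrite mulr0 -(shifted_dot _ _ hS) -AE.
have -> : A *m (x - y) = (b - A *m y) - (b - A *m x).
  by rewrite mulmxBr opprB [RHS]addrC addrA subrK.
by rewrite dotBl xo // yo // subrr.
Qed.

Lemma krylov_predS A (b : 'cV[R]_n) k : (krylov A b k.-1 <= krylov A b k)%VS.
Proof.
apply: sub_span => v /mapP[i]; rewrite mem_iota /= add0n => ik ->.
by apply: map_f; rewrite mem_iota /= add0n (leq_trans ik) ?leq_pred.
Qed.

(* The admissible vectors form a translate of a linear subspace; the iterate
   is the one orthogonal to the direction of that subspace. *)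
Lemma S3LQ_orthogonal alpha S A b k :
  alpha != 0 -> S^T = - S -> A = alpha%:M + S ->
  exists2 x, S3LQ_feasible A b k x &
    forall y, S3LQ_feasible A b k y -> dot x (y - x) = 0.
Proof.
move=> a0 hS AE; have [x0 [x0K x0o]] := S3CG_iterate_exists b k a0 hS AE.
set K' := krylov A b k.-1.
pose B := \matrix_(i < \dim K', j < n) ((vbasis K')`_i) j 0.
pose W := (krylov A b k :&: lker (linfun (mulmx (B *m A))))%VS.
have BP w : reflect (orthogonal_to (A *m w) K') (w \in lker (linfun (mulmx (B *m A)))).
  have rowE i : (B *m A *m w) i 0 = dot (A *m w) (vbasis K')`_i.
    rewrite -mulmxA mxE; apply: eq_bigr => j _.
    by rewrite [B _ _]mxE mulrC.
  rewrite memv_ker lfunE /=; apply: (iffP eqP) => [w0 v vK|wo].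
    rewrite (coord_vbasis vK) dotC.
    have /= := @big_morph _ _ (fun u => dot u (A *m w)) 0 +%R 0 +%R
       (fun u v => dotDl u v _).
    move=> ->; last by rewrite dotE trmx0 mul0mx mxE.
    by apply: big1 => i _; rewrite dotZl dotC -rowE w0 mxE mulr0.
  apply/matrixP => i j; rewrite ord1 rowE mxE; apply/wo/vbasis_mem/mem_nth.
  by rewrite size_tuple.
have S0 : (0 : 'M[R]_n)^T = - 0 by rewrite trmx0 oppr0.
have [w wW wo] := galerkin_exists x0 W (oner_neq0 R) S0.
move: wo; rewrite addr0 mul1mx => wo.
move: (wW); rewrite memv_cap => /andP[wK /BP wA].
have xF : S3LQ_feasible A b k (x0 - w).
  split; first by rewrite rpredB.
  move=> v vK; rewrite mulmxBr opprB addrCA dotDl wA //.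
  by rewrite x0o ?addr0 // (subvP (krylov_predS _ _ _)).
exists (x0 - w) => // y [yK yo]; apply: wo.
case: xF => xK xo.
rewrite memv_cap rpredB //=; apply/BP => v vK.
have -> : A *m (y - (x0 - w)) = (b - A *m (x0 - w)) - (b - A *m y).
  by rewrite (mulmxBr A y) opprB [RHS]addrC addrA subrK.
by rewrite dotBl xo // yo // subrr.
Qed.

Lemma S3LQ_pythagoras x y : dot x (y - x) = 0 ->
  dot y y = dot x x + dot (y - x) (y - x).
Proof.
set d := y - x => xd; have -> : y = x + d by rewrite addrC subrK.
by rewrite dotDl dotC dotDl [dot d (x + d)]dotC dotDl (dotC d x) xd addr0 add0r.
Qed.

Lemma S3LQ_iterate_exists alpha S A b k :
  alpha != 0 -> S^T = - S -> A = alpha%:M + S ->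
  exists x, is_S3LQ_iterate A b k x.
Proof.
move=> a0 hS AE; have [x xF xo] := S3LQ_orthogonal b k a0 hS AE.
exists x; split=> // y yF; rewrite ler_wsqrtr //.
by rewrite (S3LQ_pythagoras (xo y yF)) lerDl dot_ge0.
Qed.

Lemma S3LQ_iterate_unique alpha S A b k x y :
  alpha != 0 -> S^T = - S -> A = alpha%:M + S ->
  is_S3LQ_iterate A b k x -> is_S3LQ_iterate A b k y -> x = y.
Proof.
move=> a0 hS AE; have [z zF zo] := S3LQ_orthogonal b k a0 hS AE.
suff main t : is_S3LQ_iterate A b k t -> t = z by move=> /main -> /main ->.
move=> [tF tmin]; apply/eqP; rewrite -subr_eq0; apply/eqP/dot_eq0/eqP.
rewrite eq_le dot_ge0 andbT.
have := tmin z zF; rewrite /euclid_norm ler_sqrt ?dot_ge0 //.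
by rewrite (S3LQ_pythagoras (zo t tF)) gerDl.
Qed.

End WellDefined.

(* Main.v *)
Require Import Defs.
From HB Require Import structures.
From mathcomp Require Import all_boot all_order all_algebra.
From mathcomp Require Import reals.
Import Order.TTheory GRing.Theory Num.Theory.
Local Open Scope ring_scope.

(** Write [x] for the Galerkin iterate of index [2j] and [K_k] for the Krylov
    spaces, which are the same for [A = alpha I + S] and for [S].  The theorem
    holds because [alpha x = A^T e] for some [e] in [K_(2j-1)].

    This is a parity argument.  Powers of [S] of odd exponent are
    skew-symmetric, so the even vectors [S^(2i) b] are orthogonal to the odd
    vectors [S^(2i+1) b] ([krylov_sqr_orthogonal]).  Split [x] as [e + S f],
    with [e] and [f] in the span of the [S^(2i) b], [i < j].  The odd part of
    the residual [b - A x] is [- S (alpha f + e)]; it lies in [K_(2j)], to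
    which the residual is orthogonal, so it is zero.  Hence
    [alpha x = alpha e - S e = A^T e] ([S3CG_even_trmx]), and [e], whose
    exponents are at most [2j-2], belongs to [K_(2j-1)].

    Let [k] be [2j] or [2j+1].  Then [x] is admissible for the minimal-norm
    problem of index [k].  For any other admissible [y], [A (y - x)] is
    orthogonal to [K_(k-1)], which contains [e], so
    [alpha <x, y - x> = <e, A (y - x)> = 0].  By Pythagoras [x] has minimal
    norm ([S3LQ_iterate_trmx]), and the minimiser is unique. *)

Set Implicit Arguments.
Unset Strict Implicit.

Section Krylov.
Variables (R : realType) (n : nat).
Implicit Types (A S M : 'M[R]_n) (b u v x y : 'cV[R]_n).

Lemma dot_mulmxr M u v : dot u (M *m v) = dot (M^T *m u) v.
Proof. by rewrite !dotE trmx_mul trmxK mulmxA. Qed.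

Lemma krylov_gen M b {i k} : (i < k)%N -> M ^+ i *m b \in krylov M b k.
Proof.
by move=> ik; apply/memv_span/(map_f (fun i => _)); rewrite mem_iota add0n.
Qed.

Lemma krylov_subP M b k (U : {vspace 'cV[R]_n}) :
  (forall i, (i < k)%N -> M ^+ i *m b \in U) -> (krylov M b k <= U)%VS.
Proof.
move=> MU; apply/span_subvP => v /mapP[i]; rewrite mem_iota add0n => /= ik ->.
exact: MU.
Qed.

Lemma krylov_le M b k l : (k <= l)%N -> (krylov M b k <= krylov M b l)%VS.
Proof.
by move=> kl; apply: krylov_subP => i ik; exact/krylov_gen/(leq_trans ik).
Qed.

Lemma krylov_mul M b k v :
  v \in krylov M b k -> M *m v \in krylov M b k.+1.
Proof.
move=> vK; have : linfun (mulmx M) v \in (linfun (mulmx M) @: krylov M b k)%VS.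
  exact: memv_img.
rewrite lfunE /=; apply/subvP; rewrite limg_span; apply/span_subvP => w.
case/mapP => _ /mapP[i + ->] ->; rewrite mem_iota add0n lfunE /= => ik.
by rewrite mulmxA -[M *m _]exprS krylov_gen.
Qed.

Lemma krylov_shift_sub a M b k : (krylov (a%:M + M) b k <= krylov M b k)%VS.
Proof.
apply: krylov_subP => i ik; apply: subvP (krylov_le M b ik) _ _.
elim: i {ik} => [|i IHi]; first by rewrite expr0 (krylov_gen M b (ltn0Sn 0)).
rewrite exprS -[_ * _]/(_ *m _) -mulmxA mulmxDl mul_scalar_mx rpredD //.
  by rewrite rpredZ // (subvP (krylov_le M b (leqnSn i.+1))).
exact: krylov_mul.
Qed.

(** Krylov spaces do not change when the matrix is shifted. *)
Lemma krylov_shift a M b k : krylov (a%:M + M) b k = krylov M b k.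
Proof.
apply/eqP; rewrite eqEsubv krylov_shift_sub /=.
suff {1}-> : M = (- a)%:M + (a%:M + M) by exact: krylov_shift_sub.
by rewrite addrA -raddfD /= addNr raddf0 add0r.
Qed.

(** The exponents [2 * i] with [i < j] stop at [2 * j - 2]: this is what puts
    the even part in the smaller space of index [2 * j - 1]. *)
Lemma krylov_sqr_sub S b j u :
  u \in krylov (S ^+ 2) b j -> u \in krylov S b (2 * j).-1.
Proof.
apply/subvP/krylov_subP => i ij; rewrite -exprM; apply: krylov_gen.
by case: j ij => // j ij; rewrite mulnS /= ltnS leq_mul2l.
Qed.

Lemma krylov_parity_split S b j v : v \in krylov S b (2 * j) ->
  exists e, exists2 f, e \in krylov (S ^+ 2) b j /\ f \in krylov (S ^+ 2) b j &
    v = e + S *m f.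
Proof.
set E := krylov _ b j => vK.
suff : v \in (E + linfun (mulmx S) @: E)%VS.
  case/memv_addP => e eE [_ /memv_imgP[f fE ->] ->].
  by exists e, f; rewrite // lfunE.
apply: subvP vK; apply: krylov_subP => i ij.
have i2j : (i./2 < j)%N by rewrite ltn_half_double -mul2n.
have gE := krylov_gen (S ^+ 2) b i2j; move: gE; rewrite -exprM => gE.
rewrite -(odd_double_half i) -mul2n; case: (odd i); last first.
  by rewrite add0n (subvP (addvSl _ _)).
rewrite add1n exprS -[_ * _]/(_ *m _) -mulmxA.
apply: (subvP (addvSr _ _)); have := memv_img (linfun (mulmx S)) gE.
by rewrite lfunE.
Qed.

Lemma trmxX M i : (M ^+ i)^T = M^T ^+ i.
Proof.
elim: i => [|i IHi]; first by rewrite !expr0 trmx1.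
by rewrite exprS exprSr -IHi; exact: trmx_mul.
Qed.

Lemma skew_pow_orthogonal S b i k : S^T = - S -> odd (i + k) ->
  dot (S ^+ i *m b) (S ^+ k *m b) = 0.
Proof.
move=> hS ik; rewrite dotC dot_mulmxr trmxX hS exprNn.
rewrite -signr_odd mulmxA -[_ *m S ^+ k]/(_ * S ^+ k) -mulrA -exprD mulr_sign.
have Sik : (S ^+ (i + k))^T = - S ^+ (i + k).
  by rewrite trmxX hS exprNn -signr_odd ik expr1 mulN1r.
by case: (odd i); rewrite skew_dot0 // linearN /= Sik.
Qed.

Lemma dot_span_eq0 M (X Y : seq 'cV[R]_n) :
  {in X & Y, forall u v, dot u (M *m v) = 0} ->
  {in <<X>>%VS & <<Y>>%VS, forall u v, dot u (M *m v) = 0}.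
Proof.
have sub (Z : seq 'cV[R]_n) w : {in Z, forall u, dot u w = 0} ->
    {in <<Z>>%VS, forall u, dot u w = 0}.
  move=> Zw u /(@coord_span _ _ _ (in_tuple Z)) ->.
  apply: (big_ind (fun s => dot s w = 0)) => [|s t sw tw|i _].
  - by rewrite dotE trmx0 mul0mx mxE.
  - by rewrite dotDl sw tw addr0.
  by rewrite dotZl Zw ?mulr0 // mem_nth.
move=> XY u v uX vY; apply: (sub X) uX => {}u uX.
rewrite dot_mulmxr dotC; apply: (sub Y) vY => {}v vY.
by rewrite dotC -dot_mulmxr XY.
Qed.

(** Even vectors are orthogonal to odd ones. *)
Lemma krylov_sqr_orthogonal S b k l u v : S^T = - S ->
  u \in krylov (S ^+ 2) b k -> v \in krylov (S ^+ 2) b l ->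
  dot u (S *m v) = 0.
Proof.
move=> hS; apply: dot_span_eq0 => _ _ /mapP[i _ ->] /mapP[m _ ->].
rewrite mulmxA -!exprM -[S *m _]exprS skew_pow_orthogonal //.
by rewrite !mul2n addnS /= oddD !odd_double.
Qed.

(** The odd part of the residual vanishes, so the Galerkin iterate of even
    index is determined by its even part. *)
Lemma S3CG_even_trmx alpha S A b j x : S^T = - S -> A = alpha%:M + S ->
  (0 < j)%N -> is_S3CG_iterate A b (2 * j) x ->
  exists2 e, e \in krylov A b (2 * j).-1 & alpha *: x = A^T *m e.
Proof.
rewrite /is_S3CG_iterate => hS -> j0; rewrite !krylov_shift => -[xK xo].
have [e [f [eE fE] xE]] := krylov_parity_split xK.
exists e; first exact: krylov_sqr_sub.
(* The residual has even part [re] and odd part [- (S *m g)]. *)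
pose g := alpha *: f + e.
have gE : g \in krylov (S ^+ 2) b j by rewrite rpredD // rpredZ.
pose re := b - alpha *: e - S ^+ 2 *m f.
have reE : re \in krylov (S ^+ 2) b j.+1.
  have bE : b \in krylov (S ^+ 2) b j.+1.
    by have := krylov_gen (S ^+ 2) b (ltn0Sn j); rewrite expr0 mul1mx.
  by rewrite !rpredB ?krylov_mul // rpredZ // (subvP (krylov_le _ _ (leqnSn j))).
have resE : b - (alpha%:M + S) *m x = re - S *m g.
  rewrite xE /re /g mulmxDl mul_scalar_mx !mulmxDr scalerDr -scalemxAr.
  rewrite expr2 -[S * S]/(S *m S) -mulmxA !opprD !addrA.
  by rewrite -!addrA; congr (_ + (_ + _)); rewrite addrA addrC.
have SgK : S *m g \in krylov S b (2 * j).
  have := krylov_mul (krylov_sqr_sub gE).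
  by rewrite prednK // muln_gt0.
have Sg0 : S *m g = 0.
  apply: dot_eq0; have := xo _ SgK; rewrite resE dotBl.
  rewrite (krylov_sqr_orthogonal hS reE gE) sub0r => /eqP.
  by rewrite oppr_eq0 => /eqP.
have Sf : alpha *: (S *m f) = - (S *m e).
  by apply/eqP; rewrite -addr_eq0 scalemxAr -mulmxDr Sg0.
by rewrite xE scalerDr Sf linearD /= tr_scalar_mx hS mulmxDl mul_scalar_mx mulNmx.
Qed.

(** A feasible multiple of [A^T e], with [e] in the test space, is orthogonal
    to every feasible direction, hence has minimal norm. *)
Lemma S3LQ_iterate_trmx alpha A b k e x : alpha != 0 ->
  S3LQ_feasible A b k x -> e \in krylov A b k.-1 -> alpha *: x = A^T *m e ->
  is_S3LQ_iterate A b k x.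
Proof.
move=> a0 xF eK xE; split=> // y yF; rewrite ler_wsqrtr //.
rewrite (@S3LQ_pythagoras _ _ x y) ?lerDl ?dot_ge0 //.
apply: (mulfI a0); rewrite mulr0 -dotZl xE -dot_mulmxr dotC.
have -> : A *m (y - x) = (b - A *m x) - (b - A *m y).
  by rewrite mulmxBr opprB [RHS]addrC addrA subrK.
by rewrite dotBl xF.2 // yF.2 // subrr.
Qed.

End Krylov.

Unset Implicit Arguments.
Set Strict Implicit.

Theorem theorem11 (R : realType) (n : nat) (alpha : R) (S A : 'M[R]_n)
    (b : 'cV[R]_n) (xL xG : nat -> 'cV[R]_n)
    (halpha : alpha != 0) (hS : S^T = - S) (hA : A = alpha%:M + S)
    (hb : b != 0)
    (hxL : forall k : nat, (1 <= k)%N -> is_S3LQ_iterate A b k (xL k))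
    (hxG0 : xG 0%N = 0)
    (hxG : forall k : nat, (1 <= k)%N -> is_S3CG_iterate A b k (xG k))
    (j : nat) (hj : (1 <= j)%N)
    (hnconvL : forall k : nat, (1 <= k < 2 * j)%N -> xL k <> invmx A *m b)
    (hnconvG : forall k : nat, (k < 2 * j)%N -> xG k <> invmx A *m b) :
  xL (2 * j)%N = xL (2 * j + 1)%N /\ xL (2 * j + 1)%N = xG (2 * j)%N.
Proof.
have j2 : (0 < 2 * j)%N by rewrite muln_gt0.
have xGit := hxG _ j2; have [xK xo] := xGit.
have [e eK xE] := S3CG_even_trmx hS hA hj xGit.
have LQ0 : xL (2 * j)%N = xG (2 * j)%N.
  apply: (S3LQ_iterate_unique halpha hS hA (hxL _ j2)).
  apply: S3LQ_iterate_trmx halpha _ eK xE; split=> // v vK.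
  exact/xo/(subvP (krylov_predS _ _ _)).
have LQ1 : xL (2 * j + 1)%N = xG (2 * j)%N.
  rewrite addn1; apply: (S3LQ_iterate_unique halpha hS hA (hxL _ (ltn0Sn _))).
  apply: S3LQ_iterate_trmx halpha _ _ xE => /=.
    by split=> //; exact: subvP (krylov_predS _ _ (2 * j).+1) _ xK.
  exact: subvP (krylov_predS _ _ _) _ eK.
by rewrite LQ0 LQ1.
Qed.
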